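(* Let $m\ge 2$ and $N\ge 0$ be integers, let $c_0,\ldots,c_N\in\mathbb{C}$ with $c_N\ne 0$, and let $|\Psi\rangle=\sum_{n=0}^N c_n|\Psi_n\rangle$ (the output of a balanced $m$-port beam-splitter with input $\sum_{n=0}^N c_n|n\rangle\otimes|0,\ldots,0\rangle$). Then the Schmidt rank of $|\Psi\rangle$ with respect to every bipartition of the $m$ modes into two nonempty sets is $N+1$. Consequently $|\Psi\rangle$ is genuinely $m$-partite entangled if $N\neq 0$, and $|\Psi_n\rangle$ and $|\Psi_{n'}\rangle$ are SLOCC-inequivalent whenever $n\neq n'$.
   Context: The state space is $\mathcal{H}=\mathcal{H}_1\otimes\cdots\otimes\mathcal{H}_m$, where each mode space $\mathcal{H}_k$ is a copy of the Fock space with orthonormal number basis $|0\rangle,|1\rangle,|2\rangle,\ldots$; write $|n_1\ldots n_m\rangle=|n_1\rangle\otimes\cdots\otimes|n_m\rangle$. Two (possibly unnormalized) vectors $|\Psi\rangle,|\Phi\rangle\in\mathcal{H}$ are SLOCC-equivalent if there are invertible operators $A_k$ on $\mathcal{H}_k$ (bounded with bounded inverse), $k=1,\ldots,m$, with $|\Phi\rangle=A_1\otimes\cdots\otimes A_m|\Psi\rangle$; otherwise they are SLOCC-inequivalent. For a bipartition $\{1,\ldots,m\}=I\sqcup J$ into nonempty sets, the Schmidt rank of a vector is its tensor rank in $\left(\bigotimes_{i\in I}\mathcal{H}_i\right)\otimes\left(\bigotimes_{j\in J}\mathcal{H}_j\right)$, i.e. the rank of its coefficient matrix with rows indexed by the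 basis of the first factor and columns by the basis of the second. A state is genuinely $m$-partite entangled if its Schmidt rank is greater than $1$ for every such bipartition. For $n\ge 0$ define $$|\Psi_n\rangle=\frac{1}{m^{n/2}}\sum_{n_1+\cdots+n_m=n}\sqrt{\binom{n}{n_1,\ldots,n_m}}\,|n_1\ldots n_m\rangle,$$ where the sum runs over all tuples of non-negative integers with sum $n$ and $\binom{n}{n_1,\ldots,n_m}=\frac{n!}{n_1!\cdots n_m!}$. The state $|\Psi_n\rangle$ is the image of $|n,0,\ldots,0\rangle$ under the unitary $U_S$ of a balanced $m$-port beam-splitter, which fixes the vacuum and satisfies $U_Sa_1^\dagger U_S^\dagger=(a_1^\dagger+\cdots+a_m^\dagger)/\sqrt m$, where $a_k^\dagger$ is the creation operator of mode $k$. *)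

(* Defs.v *)
From HB Require Import structures.
From mathcomp Require Import all_boot all_order all_algebra finmap.
From mathcomp Require Import all_classical all_reals ereal esum.
From mathcomp Require Import complex ring lra.

Set Implicit Arguments.
Unset Strict Implicit.
Unset Printing Implicit Defensive.

Import Order.TTheory GRing.Theory Num.Theory.
Import ComplexField.

Local Open Scope classical_set_scope.
Local Open Scope ring_scope.
Local Open Scope complex_scope.

Lemma normc_ge0 (R : rcfType) (z : R[i]) : 0 <= Normc.normc z.
Proof. by case: z => a b /=; exact: sqrtr_ge0. Qed.

Lemma ler_sum_sub (R : numDomainType) (T : eqType) (F : T -> R) (r s : seq T) :
  (forall t, 0 <= F t) -> uniq r -> uniq s -> {subset r <= s} ->
  \sum_(t <- r) F t <= \sum_(t <- s) F t.
Proof.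
move=> F0 ur us rs.
have -> : \sum_(t <- r) F t = \sum_(t <- s | t \in r) F t.
  rewrite -[RHS]big_filter; apply: perm_big; apply: uniq_perm => //.
    by rewrite filter_uniq.
  by move=> t; rewrite mem_filter; case: (boolP (t \in r)) => // /rs ->.
by rewrite big_mkcond/=; apply: ler_sum => t _; case: ifP.
Qed.

Section SquareSummable.
Variables (R : realType) (T : choiceType).
Implicit Types f g : T -> R[i].

(* The square [\sum_t |f t| ^ 2] of the Hilbert norm, possibly [+oo]. *)
Definition normsq f : \bar R :=
  \esum_(t in [set: T]) (Normc.normc (f t) ^+ 2)%:E.

Definition square_summable : {pred T -> R[i]} := fun f => (normsq f < +oo)%E.

Lemma square_summableP f :
  f \in square_summable <->
  exists M : R, forall X : {fset T},
    \sum_(t <- X) Normc.normc (f t) ^+ 2 <= M.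
Proof.
rewrite unfold_in /square_summable /normsq; split => [foo|[M fM]].
  have f0 : (0 <= \esum_(t in [set: T]) (Normc.normc (f t) ^+ 2)%:E)%E.
    by apply: esum_ge0 => t _; rewrite lee_fin sqr_ge0.
  have ffin : \esum_(t in [set: T]) (Normc.normc (f t) ^+ 2)%:E \is a fin_num.
    by rewrite ge0_fin_numE.
  exists (fine (\esum_(t in [set: T]) (Normc.normc (f t) ^+ 2)%:E)) => X.
  rewrite -lee_fin fineK// -sumEFin esum_ge//; exists [set` X] => //.
  by rewrite fsbig_finite//= set_fsetK.
apply: (@le_lt_trans _ _ M%:E); last exact: ltry.
apply: ge_ereal_sup => _ [X [finX _] <-].
by rewrite fsbig_finite//= sumEFin lee_fin.
Qed.

Lemma square_summable_finsupp f (s : seq T) :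
  (forall t, f t != 0 -> t \in s) -> f \in square_summable.
Proof.
move=> fs; apply/square_summableP.
exists (\sum_(t <- undup s) Normc.normc (f t) ^+ 2) => X.
rewrite (bigID (fun t => t \in s))/= addrC big1 ?add0r; last first.
  move=> t ts; have -> : f t = 0 by apply/eqP; apply: contraNT ts => /fs.
  by rewrite Normc.normc0 expr0n.
rewrite -big_filter; apply: ler_sum_sub => [t|||t]; rewrite ?sqr_ge0//.
- by rewrite filter_uniq.
- exact: undup_uniq.
- by rewrite mem_filter mem_undup => /andP[].
Qed.

Lemma square_summable_submod : submod_closed square_summable.
Proof.
split=> [|a f g /square_summableP[M fM] /square_summableP[N gN]].
  apply/square_summableP; exists 0 => X.
  by rewrite big1// => t _; rewrite Normc.normc0 expr0n.
apply/square_summableP; exists (2 * Normc.normc a ^+ 2 * M + 2 * N) => X.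
apply: (@le_trans _ _ (\sum_(t <- X)
  (2 * Normc.normc a ^+ 2 * Normc.normc (f t) ^+ 2 +
   2 * Normc.normc (g t) ^+ 2))); last first.
  rewrite big_split/= -!mulr_sumr lerD//.
    by rewrite ler_wpM2l// mulr_ge0// sqr_ge0.
  by rewrite ler_wpM2l.
apply: ler_sum => t _.
have := le_normcD (a * f t) (g t); rewrite Normc.normcM => h.
rewrite -mulrA -exprMn -mulrDr.
set x := Normc.normc a * _ in h *; set y := Normc.normc (g t) in h *.
apply: (@le_trans _ _ ((x + y) ^+ 2)).
  by rewrite lerXn2r ?nnegrE ?addr_ge0 ?mulr_ge0 ?normc_ge0.
by have := sqr_ge0 (x - y); lra.
Qed.

HB.instance Definition _ :=
  GRing.isSubmodClosed.Build R[i] (T -> R[i]) square_summable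
    square_summable_submod.

(* The Hilbert space of square-summable families with orthonormal basis [T]: a
   vector is the family of its coefficients in that basis. *)
Record ell2 := Ell2 { coef :> T -> R[i]; _ : coef \in square_summable }.

HB.instance Definition _ := [isSub for coef].
HB.instance Definition _ := [Choice of ell2 by <:].
HB.instance Definition _ := [SubChoice_isSubLmodule of ell2 by <:].

Definition norm2 (f : ell2) : R := Num.sqrt (fine (normsq f)).

End SquareSummable.

Definition bounded_op (R : realType) (T U : choiceType)
    (A : ell2 R T -> ell2 R U) : Prop :=
  exists M : R, forall f, norm2 (A f) <= M * norm2 f.

Definition bounded_invertible (R : realType) (T : choiceType)
    (A : {linear ell2 R T -> ell2 R T}) : Prop :=
  bounded_op A /\
  exists B : {linear ell2 R T -> ell2 R T},
    [/\ bounded_op B, cancel A B & cancel B A].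

Section Modes.
Variables (R : realType) (K : finType).

(* [fock R] is a single-mode space, with number basis [nat]; [multimode R K] is
   the Hilbert tensor product of copies of it indexed by [K], with basis the
   occupation numbers [{ffun K -> nat}]. *)
Definition fock := ell2 R nat.
Definition multimode := ell2 R {ffun K -> nat}.

Definition box (b : nat) : seq {ffun K -> nat} :=
  [seq [ffun i => val (g i)] | g : {ffun K -> 'I_b.+1}].

Lemma box_uniq b : uniq (box b).
Proof.
rewrite map_inj_uniq ?enum_uniq// => g h /ffunP gh.
by apply/ffunP => i; apply: val_inj; have := gh i; rewrite !ffunE.
Qed.

Lemma mem_box b (n : {ffun K -> nat}) :
  (forall i, (n i <= b)%N) -> n \in box b.
Proof.
move=> nb; apply/mapP; exists [ffun i => inord (n i)]; rewrite ?mem_enum//.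
by apply/ffunP => i; rewrite !ffunE /= inordK// ltnS.
Qed.

Lemma tensor_vec_subproof (v : K -> fock) :
  (fun n : {ffun K -> nat} => \prod_i v i (n i)) \in @square_summable R _.
Proof.
have /choice[M vM] : forall i, exists M : R, forall X : {fset nat},
    \sum_(t <- X) Normc.normc (v i t) ^+ 2 <= M.
  by move=> i; apply/square_summableP; exact: valP.
apply/square_summableP; exists (\prod_i M i) => X.
pose b := (\max_(n <- X) \max_i (n : {ffun K -> nat}) i)%N.
apply: (@le_trans _ _ (\sum_(n <- box b)
    Normc.normc (\prod_i v i (n i)) ^+ 2)).
  apply: ler_sum_sub => [n|||n nX]; rewrite ?sqr_ge0 ?box_uniq//.
  apply: mem_box => i; rewrite /b (big_rem n)//=.
  by rewrite (leq_trans _ (leq_maxl _ _))// (leq_bigmax i).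
rewrite /box big_map big_enum/=.
have normcX (g : {ffun K -> 'I_b.+1}) :
    Normc.normc (\prod_i v i ([ffun i => val (g i)] i)) ^+ 2 =
    \prod_i Normc.normc (v i (g i)) ^+ 2.
  rewrite (big_morph _ (@Normc.normcM R) (@Normc.normc1 R)) prodrXl.
  by congr (_ ^+ 2); apply: eq_bigr => i _; rewrite ffunE.
rewrite (eq_bigr _ (fun g _ => normcX g)).
rewrite -(bigA_distr_bigA (fun i (k : 'I_b.+1) => Normc.normc (v i k) ^+ 2)).
apply: ler_prod => i _; apply/andP; split.
  by apply: sumr_ge0 => k _; rewrite sqr_ge0.
apply: le_trans (vM i [fset k | k in iota 0 b.+1]%fset).
rewrite -(big_mkord xpredT (fun k => Normc.normc (v i k) ^+ 2)).
apply: ler_sum_sub => [k|||k]; rewrite ?sqr_ge0 ?iota_uniq//.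
- exact: fset_uniq.
- by rewrite /index_iota subn0 => kb; apply/imfsetP; exists k.
Qed.

(* The product vector [v_1 (x) ... (x) v_m]. *)
Definition tensor_vec (v : K -> fock) : multimode :=
  Ell2 (tensor_vec_subproof v).

(* [AA] is the bounded operator [A_1 (x) ... (x) A_m]: for bounded [A k] there
   is exactly one such [AA], as product vectors span a dense subspace. *)
Definition is_tensor_op (A : K -> {linear fock -> fock})
    (AA : {linear multimode -> multimode}) : Prop :=
  bounded_op AA /\
  forall v : K -> fock, AA (tensor_vec v) = tensor_vec (fun k => A k (v k)).

Definition slocc_equiv (Psi Phi : multimode) : Prop :=
  exists (A : K -> {linear fock -> fock})
         (AA : {linear multimode -> multimode}),
    [/\ forall k, bounded_invertible (A k), is_tensor_op A AA
      & Phi = AA Psi].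

Definition bipartition (I J : {set K}) : Prop :=
  [/\ I != finset.set0, J != finset.set0,
      (I :&: J)%SET = finset.set0
    & (I :|: J)%SET = finset.setT].

Definition restr (I : {set K}) (n : {ffun K -> nat}) :
    {ffun {i | i \in I} -> nat} :=
  [ffun i => n (val i)].

(* [Psi] is a sum of [r] product vectors across the cut [I], [J]. *)
Definition tensor_sum (I J : {set K}) (Psi : multimode) (r : nat) : Prop :=
  exists (u : 'I_r -> ell2 R {ffun {i | i \in I} -> nat})
         (v : 'I_r -> ell2 R {ffun {j | j \in J} -> nat}),
    forall n, Psi n = \sum_(l < r) u l (restr I n) * v l (restr J n).

(* Tensor rank across the cut, [+oo] if there is no finite decomposition. *)
Definition schmidt_rank (I J : {set K}) (Psi : multimode) : \bar R :=
  ereal_inf [set (r%:R)%:E | r in tensor_sum I J Psi].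

Definition genuinely_entangled (Psi : multimode) : Prop :=
  forall I J : {set K}, bipartition I J -> (1 < schmidt_rank I J Psi)%E.

End Modes.

Section SplitNumberState.
Variables (R : realType) (m n : nat).

Definition split_coef (k : {ffun 'I_m -> nat}) : R[i] :=
  if (\sum_i k i == n)%N then
    (Num.sqrt (n`!%:R / (\prod_i (k i)`!)%:R) / Num.sqrt m%:R ^+ n)%:C
  else 0.

Lemma split_coef_subproof : split_coef \in @square_summable R _.
Proof.
apply: (@square_summable_finsupp _ _ _ (box _ n)) => k.
rewrite /split_coef; case: (\sum_i k i =P n)%N => [kn _|]; last by rewrite eqxx.
by apply: mem_box => i; rewrite -kn (bigD1 i)//= leq_addr.
Qed.

(* The vector [|Psi_n>] on [m] modes. *)
Definition split_number : multimode R 'I_m := Ell2 split_coef_subproof.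

End SplitNumberState.

(* Main.v *)
Require Import Defs.
From HB Require Import structures.
From mathcomp Require Import all_boot all_order all_algebra finmap.
From mathcomp Require Import all_classical all_reals ereal esum.
From mathcomp Require Import complex.

(* The coefficient of [Psi] at [k] is [d |k| * \prod_i w (k i)], with [d] zero
   above [N] and [d N], [w] nonzero. Grouping by the number of particles on one
   side of a cut gives [N + 1] product terms, and a triangular minor shows that
   fewer do not suffice, even without square-summability.
   For SLOCC, a vector supported in a finite box has the same cut rank as its
   image: the columns of each injective [A_k] that matter are finitely many and
   independent, so finitely many entries of the image suffice to recover the
   vector by local linear maps. *)

Set Implicit Arguments.
Unset Strict Implicit.
Unset Printing Implicit Defensive.

Import Order.TTheory GRing.Theory Num.Theory.

Local Open Scope classical_set_scope.
Local Open Scope ring_scope.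
Local Open Scope complex_scope.

(** * Coordinates and number basis of [ell2] *)

Lemma coef_sum (R : realType) (T : choiceType) (I : Type) (r : seq I)
    (P : pred I) (f : I -> ell2 R T) (t : T) :
  (\sum_(i <- r | P i) f i) t = \sum_(i <- r | P i) f i t.
Proof. by apply: (big_morph (fun g : ell2 R T => g t)). Qed.

Lemma coefZ (R : realType) (T : choiceType) (a : R[i]) (f : ell2 R T) (t : T) :
  (a *: f) t = a * f t.
Proof. by []. Qed.

Lemma ell2P (R : realType) (T : choiceType) (f g : ell2 R T) :
  (forall t, f t = g t) -> f = g.
Proof. by move=> fg; apply/val_inj/funext. Qed.

Lemma basis_vec_subproof (R : realType) (T : choiceType) (t : T) :
  (fun s => (s == t)%:R) \in @square_summable R T.
Proof.
apply: (@square_summable_finsupp _ _ _ [:: t]) => s.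
by rewrite inE; case: (s == t) => //; rewrite mulr0n eqxx.
Qed.

Definition basis_vec (R : realType) (T : choiceType) (t : T) : ell2 R T :=
  Ell2 (basis_vec_subproof R t).

(** * Dual families on finitely many coordinates *)

Section FiniteDual.
Variables (F : fieldType) (b : nat) (f : 'I_b -> nat -> F).
Hypothesis free_f : forall a : 'I_b -> F,
  (forall t, \sum_k a k * f k t = 0) -> forall k, a k = 0.

Let trunc T : 'M[F]_(b, T) := \matrix_(k, t) f k t.

Let trunc_ker T T' : (T <= T')%N -> (kermx (trunc T') <= kermx (trunc T))%MS.
Proof.
move=> TT'; apply/sub_kermxP/matrixP => i t.
have /matrixP/(_ i (widen_ord TT' t)) := mulmx_ker (trunc T').
rewrite !mxE => h; rewrite -[RHS]h.
by apply: eq_bigr => k _; rewrite !mxE.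
Qed.

(* The kernels of the truncations decrease with [T]; the one of least rank is
   contained in all of them, so it is zero. *)
Lemma finite_dual : exists T0, forall T, (T0 <= T)%N ->
  exists q : 'I_T -> 'I_b -> F, forall k k',
  \sum_(t < T) f k t * q t k' = (k == k')%:R.
Proof.
have exr : exists r, `[< exists T, \rank (kermx (trunc T)) = r >].
  by exists (\rank (kermx (trunc 0))); apply/asboolP; exists 0%N.
case: (ex_minnP exr) => r /asboolP[T0 rT0] rmin.
have ker0 : kermx (trunc T0) = 0.
  apply/matrixP => i k; rewrite [RHS]mxE.
  apply: (free_f (a := fun k => kermx (trunc T0) i k)) => t.
  (* The length [T'] includes column [t]; minimality of the rank at [T0] turns the inclusion of
     kernels into an equality, so row [i] annihilates that column too. *)
  pose T' := maxn T0 t.+1.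
  have tT' : (t < T')%N by rewrite leq_maxr.
  have /rmin : `[< exists T1,
      \rank (kermx (trunc T1)) = \rank (kermx (trunc T')) >].
    by apply/asboolP; exists T'.
  rewrite -rT0 => le_rk.
  have sub := trunc_ker (leq_maxl T0 t.+1).
  have /sub_kermxP/matrixP/(_ i (Ordinal tT')) :
      (kermx (trunc T0) <= kermx (trunc T'))%MS.
    by case: (mxrank_leqif_sup sub) => _ <-; rewrite eqn_leq le_rk mxrankS.
  rewrite !mxE => h; rewrite -[RHS]h.
  by apply: eq_bigr => l _; rewrite !mxE.
exists T0 => T /trunc_ker; rewrite ker0 submx0 kermx_eq0 => row_freeT.
(* The pseudo-inverse of a row-free matrix is a right inverse; its columns form the dual family. *)
exists (fun t k => pinvmx (trunc T) t k) => k k'.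
have /matrixP/(_ k k') : trunc T *m pinvmx (trunc T) = 1%:M.
  exact: mulmxVp row_freeT.
by rewrite !mxE => <-; apply: eq_bigr => t _; rewrite [in RHS]mxE.
Qed.

End FiniteDual.

(** * Splitting products and box configurations along a cut *)

Lemma in_bipartitionr (K : finType) (I J : {set K}) (i : K) :
  bipartition I J -> (i \in J) = (i \notin I).
Proof.
case=> _ _ /setP/(_ i) + /setP/(_ i); rewrite !inE.
by case: (i \in I); case: (i \in J).
Qed.

Lemma big_bipartition (S : Type) (idx : S) (op : Monoid.com_law idx)
    (K : finType) (I J : {set K}) (f : K -> S) :
  bipartition I J ->
  \big[op/idx]_i f i =
  op (\big[op/idx]_(i : {i | i \in I}) f (val i))
     (\big[op/idx]_(j : {j | j \in J}) f (val j)).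
Proof.
move=> IJ; rewrite (bigID (fun i => i \in I))/= big_sub; congr (op _ _).
rewrite -big_sub; apply: eq_bigl => i; exact/esym/in_bipartitionr.
Qed.

Section Glue.
Variables (K : finType) (I J : {set K}) (b : nat).
Hypothesis IJ : bipartition I J.

(** Reindexing along this map splits a sum over configurations of all modes into a double sum over
    those of the two sides. *)
Definition glue (p : {ffun {i | i \in I} -> 'I_b.+1} *
                     {ffun {j | j \in J} -> 'I_b.+1}) : {ffun K -> 'I_b.+1} :=
  [ffun i => if insub i is Some s then p.1 s
             else if insub i is Some s then p.2 s else ord0].

Lemma glue_l p (i : {i | i \in I}) : glue p (val i) = p.1 i.
Proof. by rewrite ffunE valK. Qed.

Lemma glue_r p (j : {j | j \in J}) : glue p (val j) = p.2 j.
Proof.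
rewrite ffunE insubF ?valK//; apply/negbTE.
by rewrite -(in_bipartitionr _ IJ); exact: valP.
Qed.

Lemma glue_bij : bijective glue.
Proof.
exists (fun g : {ffun K -> 'I_b.+1} =>
  ([ffun i : {i | i \in I} => g (val i)],
   [ffun j : {j | j \in J} => g (val j)])) => [[x y]|g].
  by congr pair; apply/ffunP => i; rewrite ffunE ?glue_l ?glue_r.
apply/ffunP => i; have [iI|iJ] := boolP (i \in I).
  by apply: (etrans (glue_l _ (exist _ i iI))); rewrite ffunE.
rewrite -(in_bipartitionr _ IJ) in iJ.
by apply: (etrans (glue_r _ (exist _ i iJ))); rewrite ffunE.
Qed.

End Glue.

(** * Expansion of box-supported functions *)

Lemma prod_delta (F : comPzSemiRingType) (K : finType) (S : eqType)
    (g k : {ffun K -> S}) :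
  \prod_i (g i == k i)%:R = (g == k)%:R :> F.
Proof.
have [->|gk] := eqVneq g k; first by rewrite big1// => i _; rewrite eqxx.
have /existsP[i gki] : [exists i, g i != k i].
  apply: contraNT gk; rewrite negb_exists => /forallP gk.
  by apply/eqP/ffunP => i; apply/eqP; rewrite -[_ == _]negbK.
by rewrite (bigD1 i)//= (negbTE gki) mul0r.
Qed.

(** The indicator is kept as a product over modes, so that its factors can later be replaced mode by
    mode. *)
Lemma delta_expansion (F : comPzSemiRingType) (K : finType) b
    (Psi : {ffun K -> nat} -> F) (k : {ffun K -> nat}) :
  (forall n : {ffun _ -> nat}, Psi n != 0 -> forall i, (n i <= b)%N) ->
  Psi k = \sum_(g : {ffun K -> 'I_b.+1})
    (\prod_i (val (g i) == k i)%:R) * Psi [ffun i => val (g i)].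
Proof.
move=> supp.
have gE (g : {ffun K -> 'I_b.+1}) :
    \prod_i (val (g i) == k i)%:R = ([ffun i => val (g i)] == k)%:R :> F.
  by rewrite -prod_delta; apply: eq_bigr => i _; rewrite ffunE.
under eq_bigr do rewrite gE.
have [kb|] := boolP (k \in box K b).
  have [g _ kE] := mapP kb.
  rewrite (bigD1 g)//= -kE eqxx mul1r big1 ?addr0// => h hg.
  case: eqP => [|_]; last by rewrite mul0r.
  rewrite kE => /ffunP gh; case/eqP: hg.
  by apply/ffunP => i; apply: val_inj; have := gh i; rewrite !ffunE.
move=> kb; rewrite big1 => [|g _].
  by apply/eqP; apply: contraNT kb => /supp; exact: mem_box.
case: eqP => [gk|_]; last by rewrite mul0r.
by case/negP: kb; rewrite -gk; apply: mem_box => i; rewrite ffunE leq_ord.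
Qed.

(** * Algebraic cut rank and local linear maps *)

Section CutSum.
Variables (F : fieldType) (K : finType).
Implicit Types (I J : {set K}) (Psi : {ffun K -> nat} -> F).

(* The decompositions of [tensor_sum] without square-summability of the terms. *)
Definition cut_sum I J Psi (r : nat) : Prop :=
  exists (u : 'I_r -> {ffun {i | i \in I} -> nat} -> F)
         (v : 'I_r -> {ffun {j | j \in J} -> nat} -> F),
    forall n, Psi n = \sum_(l < r) u l (restr I n) * v l (restr J n).

(* Occupying one mode [i0] of [I] and one mode [j0] of [J], with [j] and
   [N - i] particles, gives a triangular minor of order [N + 1]. *)
Lemma cut_sum_degree_lt I J Psi N r : bipartition I J ->
  (forall k : {ffun _ -> nat}, (N < \sum_i k i)%N -> Psi k = 0) ->
  (forall k : {ffun _ -> nat}, (\sum_i k i)%N = N -> Psi k != 0) ->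
  cut_sum I J Psi r -> (N < r)%N.
Proof.
move=> IJ PsiN0 PsiN [u [v Psiuv]].
have [/set0Pn[i0 i0I] /set0Pn[j0 j0J] _ _] := IJ.
have j0i0 : j0 != i0.
  by apply: contraTneq j0J => ->; rewrite (in_bipartitionr _ IJ) i0I.
pose pt a c := [ffun i => if i == i0 then a else if i == j0 then c else 0%N].
have sum_pt a c : (\sum_i pt a c i)%N = (a + c)%N.
  rewrite (bigD1 i0)//= (bigD1 j0)//= !ffunE !eqxx (negbTE j0i0) big1 ?addn0//.
  by move=> i /andP[/negbTE ii0 /negbTE ij0]; rewrite ffunE ii0 ij0.
have restrI a c : restr I (pt a c) = restr I (pt a 0%N).
  apply/ffunP => i; rewrite !ffunE; case: eqP => // _; case: eqP => // ij0.
  by move: j0J; rewrite -ij0 (in_bipartitionr _ IJ) (valP i).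
have restrJ a c : restr J (pt a c) = restr J (pt 0%N c).
  apply/ffunP => j; rewrite !ffunE; case: eqP => // ji0.
  by move: (valP j); rewrite (in_bipartitionr _ IJ) ji0 i0I.
(* Entry [(i, j)] has total degree [j + (N - i)]: this is [N] on the diagonal and exceeds [N] above
   it. *)
pose M : 'M[F]_N.+1 := \matrix_(i, j) Psi (pt j (N - i)%N).
have -> : N.+1 = \rank M.
  apply/esym/mxrank_unit; rewrite unitmxE unitfE det_trig.
    apply/prodf_neq0 => i _; rewrite mxE; apply: PsiN.
    by rewrite sum_pt subnKC// -ltnS.
  apply/is_trig_mxP => i j ij; rewrite mxE; apply: PsiN0.
  by rewrite sum_pt -[ltnLHS](@subnKC i) ?ltn_add2r// -ltnS.
(* A sum of [r] products factors the minor through dimension [r]. *)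
have -> : M = (\matrix_(i, l) v l (restr J (pt 0%N (N - i)%N))) *m
              (\matrix_(l, j) u l (restr I (pt j 0%N))).
  apply/matrixP => i j; rewrite !mxE Psiuv; apply: eq_bigr => l _.
  by rewrite !mxE mulrC restrI restrJ.
exact: mulmx_max_rank.
Qed.

(** Tensor product of local maps, with [q i k] the image of basis vector [k] of mode [i]. The sum
    over the box is finite, so convergence does not arise. *)
Definition local_transform b (q : K -> 'I_b.+1 -> nat -> F) Psi
    (t : {ffun K -> nat}) : F :=
  \sum_(g : {ffun K -> 'I_b.+1})
    (\prod_i q i (g i) (t i)) * Psi [ffun i => val (g i)].

(** The kernel is a product over modes, hence factors across the cut and sends each product term to
    a product term. *)
Lemma cut_sum_local_transform I J Psi b (q : K -> 'I_b.+1 -> nat -> F) r :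
  bipartition I J -> cut_sum I J Psi r ->
  cut_sum I J (local_transform q Psi) r.
Proof.
move=> IJ [u [v Psiuv]].
exists (fun l x => \sum_(g : {ffun {i | i \in I} -> 'I_b.+1})
          (\prod_i q (val i) (g i) (x i)) * u l [ffun i => val (g i)]).
exists (fun l y => \sum_(g : {ffun {j | j \in J} -> 'I_b.+1})
          (\prod_j q (val j) (g j) (y j)) * v l [ffun j => val (g j)]).
move=> t; rewrite /local_transform.
under [RHS]eq_bigr do rewrite big_distrlr pair_bigA/=.
rewrite exchange_big/= (reindex (@glue _ I J b)); last first.
  exact/onW_bij/glue_bij.
apply: eq_bigr => p _; rewrite Psiuv mulr_sumr; apply: eq_bigr => l _.
rewrite (big_bipartition _ _ IJ)/= mulrACA; congr (_ * _ * (_ * _)).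
- by apply: eq_bigr => i _; rewrite glue_l ffunE.
- by congr (u l _); apply/ffunP => i; rewrite 2!ffunE glue_l ffunE.
- by apply: eq_bigr => j _; rewrite glue_r// ffunE.
- by congr (v l _); apply/ffunP => j; rewrite 2!ffunE glue_r// ffunE.
Qed.

(** Contracting each mode with a dual family undoes the local maps, using only finitely many entries
    of the image. *)
Lemma local_transform_inv Psi b (q : K -> 'I_b.+1 -> nat -> F) :
  (forall i (a : 'I_b.+1 -> F),
    (forall t, \sum_k a k * q i k t = 0) -> forall k, a k = 0) ->
  (forall k : {ffun _ -> nat}, Psi k != 0 -> forall i, (k i <= b)%N) ->
  exists T (q' : K -> 'I_T.+1 -> nat -> F),
    Psi = local_transform q' (local_transform q Psi).
Proof.
move=> free_q supp.
have /choice[T0 T0P] := fun i => finite_dual (free_q i).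
(* One length serves all modes, as [T0P] holds for every larger length. *)
pose T := (\max_i T0 i)%N.
have /choice[d dP] : forall i, exists d : 'I_T.+1 -> 'I_b.+1 -> F,
    forall k k', \sum_(t < T.+1) q i k t * d t k' = (k == k')%:R.
  by move=> i; apply: T0P; rewrite ltnW// ltnS leq_bigmax.
exists T, (fun i t k => if insub k is Some k' then d i t k' else 0).
apply/funext => k; rewrite (delta_expansion k supp) /local_transform.
under [RHS]eq_bigr do rewrite mulr_sumr.
rewrite exchange_big/=; apply: eq_bigr => g _.
(* Each delta becomes a contraction of [q] with its dual; for [k i] above [b] the default 0 matches
   the vanishing delta. *)
have qd i : (val (g i) == k i)%:R = \sum_(t < T.+1)
    (if insub (k i) is Some k' then d i t k' else 0) * q i (g i) t.
  case: insubP => [k' _ <-|kib]; last first.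
    rewrite big1 => [|t _]; rewrite ?mul0r// ltn_eqF//.
    by rewrite (leq_trans (ltn_ord _))// leqNgt.
  by rewrite (inj_eq val_inj) -(dP i); apply: eq_bigr => t _; rewrite mulrC.
under [X in X * _]eq_bigr do rewrite qd.
rewrite bigA_distr_bigA mulr_suml; apply: eq_bigr => t _.
rewrite mulrA; congr (_ * _); rewrite -big_split/=; apply: eq_bigr => i _.
by rewrite ffunE.
Qed.

End CutSum.

Lemma tensor_sum_cut_sum (R : realType) (K : finType) (I J : {set K})
    (Psi : multimode R K) r :
  tensor_sum I J Psi r -> cut_sum I J Psi r.
Proof. by move=> [u [v uv]]; exists u, v. Qed.

(** * Schmidt rank of graded vectors *)

Section Graded.
Variables (R : realType) (K : finType).

Lemma square_summable_degree (L : finType) (f : {ffun L -> nat} -> R[i]) N :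
  (forall k : {ffun _ -> nat}, (N < \sum_i k i)%N -> f k = 0) ->
  f \in @square_summable R _.
Proof.
move=> f0; apply: (@square_summable_finsupp _ _ _ (box L N)) => k fk.
apply: mem_box => i; rewrite (@leq_trans (\sum_i k i)%N)//.
  by rewrite (bigD1 i)//= leq_addr.
by rewrite leqNgt; apply: contraNN fk => /f0 ->.
Qed.

Variables (N : nat) (d w : nat -> R[i]) (Psi : multimode R K).
Hypothesis PsiE : forall k : {ffun K -> nat},
  Psi k = d (\sum_i k i)%N * \prod_i w (k i).
Hypothesis d0 : forall n, (N < n)%N -> d n = 0.

(** Term [l] collects the configurations with [l] particles in [I]; fixing [l] decouples the two
    sides, since [d] then depends only on the number in [J]. *)
Lemma tensor_sum_graded (I J : {set K}) :
  bipartition I J -> tensor_sum I J Psi N.+1.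
Proof.
move=> IJ.
pose u l (x : {ffun {i | i \in I} -> nat}) : R[i] :=
  if (\sum_i x i == l)%N then \prod_i w (x i) else 0.
pose v l (y : {ffun {j | j \in J} -> nat}) : R[i] :=
  d (l + \sum_j y j)%N * \prod_j w (y j).
have uP (l : 'I_N.+1) : u l \in @square_summable R _.
  apply: (@square_summable_degree _ _ l) => x lx.
  by rewrite /u gtn_eqF.
have vP (l : 'I_N.+1) : v l \in @square_summable R _.
  apply: (@square_summable_degree _ _ N) => y Ny.
  by rewrite /v d0 ?mul0r// (leq_trans Ny)// leq_addl.
exists (fun l => Ell2 (uP l)), (fun l => Ell2 (vP l)) => k /=.
rewrite PsiE (big_bipartition _ k IJ) (big_bipartition _ _ IJ)/=.
rewrite /u /v.
have -> : (\sum_(i : {i | i \in I}) restr I k i =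
           \sum_(i : {i | i \in I}) k (val i))%N.
  by apply: eq_bigr => i _; rewrite ffunE.
have -> : (\sum_(j : {j | j \in J}) restr J k j =
           \sum_(j : {j | j \in J}) k (val j))%N.
  by apply: eq_bigr => i _; rewrite ffunE.
have -> : \prod_(i : {i | i \in I}) w (restr I k i) =
           \prod_(i : {i | i \in I}) w (k (val i)).
  by apply: eq_bigr => i _; rewrite ffunE.
have -> : \prod_(j : {j | j \in J}) w (restr J k j) =
           \prod_(j : {j | j \in J}) w (k (val j)).
  by apply: eq_bigr => i _; rewrite ffunE.
set sI := (\sum_(i : {i | i \in I}) _)%N.
set sJ := (\sum_(j : {j | j \in J}) _)%N.
have [sIN|Ns] := leqP sI N.
  have sIN' : (sI < N.+1)%N by [].
  rewrite (bigD1 (Ordinal sIN'))//= eqxx [X in _ + X]big1 ?addr0 => [|l lsI].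
    by rewrite mulrCA.
  case: eqP => [sIl|_]; last by rewrite mul0r.
  by case/eqP: lsI; apply: val_inj.
(* With more than [N] particles in [I], the coefficient and every term vanish. *)
rewrite d0 ?mul0r ?(leq_trans Ns) ?leq_addr// big1// => l _.
by rewrite gtn_eqF ?mul0r// (leq_trans _ Ns)// ltnS -ltnS.
Qed.

Hypothesis dN : d N != 0.
Hypothesis w_neq0 : forall j, w j != 0.

Lemma cut_sum_graded_lt (I J : {set K}) r :
  bipartition I J -> cut_sum I J Psi r -> (N < r)%N.
Proof.
move=> IJ; apply: cut_sum_degree_lt => // k kN; rewrite PsiE.
  by rewrite d0 ?mul0r.
by rewrite kN mulf_neq0//; apply/prodf_neq0.
Qed.

Lemma schmidt_rank_graded (I J : {set K}) :
  bipartition I J -> schmidt_rank I J Psi = (N.+1%:R)%:E.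
Proof.
move=> IJ; apply/eqP; rewrite eq_le; apply/andP; split.
  by apply: ereal_inf_lbound; exists N.+1 => //; exact: tensor_sum_graded.
apply/ereal_infP => _ [r /tensor_sum_cut_sum/(cut_sum_graded_lt IJ) Nr <-].
by rewrite lee_fin ler_nat.
Qed.

End Graded.

(** * Invariance of the cut rank under SLOCC *)

Section Slocc.
Variables (R : realType) (K : finType).

Lemma basis_expansion b (Psi : multimode R K) :
  (forall k : {ffun _ -> nat}, Psi k != 0 -> forall i, (k i <= b)%N) ->
  Psi = \sum_(g : {ffun K -> 'I_b.+1})
    Psi [ffun i => val (g i)] *: tensor_vec (fun i => basis_vec R (val (g i))).
Proof.
move=> supp; apply: ell2P => k; rewrite coef_sum (delta_expansion k supp).
apply: eq_bigr => g _; rewrite coefZ mulrC; congr (_ * _).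
by apply: eq_bigr => i _; rewrite eq_sym.
Qed.

(** The expansion of [Psi] in product basis vectors is finite, so linearity and the action on
    product vectors determine the image. *)
Lemma tensor_op_local_transform b (A : K -> {linear fock R -> fock R})
    (AA : {linear multimode R K -> multimode R K}) (Psi : multimode R K) :
  (forall k : {ffun _ -> nat}, Psi k != 0 -> forall i, (k i <= b)%N) ->
  is_tensor_op A AA ->
  AA Psi = local_transform
    (fun i (k : 'I_b.+1) t => A i (basis_vec R (val k)) t) Psi
    :> ({ffun K -> nat} -> R[i]).
Proof.
move=> supp [_ AAv]; apply/funext => t.
rewrite {1}(basis_expansion supp) linear_sum coef_sum; apply: eq_bigr => g _.
by rewrite linearZ coefZ AAv mulrC.
Qed.

(** Applying the inverse [B] to a vanishing combination leaves a relation between basis vectors. *)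
Lemma bounded_invertible_free b (A : {linear fock R -> fock R}) :
  bounded_invertible A -> forall a : 'I_b.+1 -> R[i],
  (forall t, \sum_k a k * A (basis_vec R (val k)) t = 0) -> forall k, a k = 0.
Proof.
move=> [_ [B [_ AK _]]] a aA k.
have A0 : A (\sum_k a k *: basis_vec R (val k)) = 0.
  apply: ell2P => t; rewrite linear_sum coef_sum -[RHS](aA t).
  by apply: eq_bigr => j _; rewrite linearZ coefZ.
have := congr1 (fun f : fock R => f (val k)) (congr1 B A0).
rewrite AK linear0 coef_sum; under eq_bigr do rewrite coefZ/=.
rewrite (bigD1 k)//= eqxx mulr1 big1 ?addr0// => j jk.
by rewrite (inj_eq val_inj) eq_sym (negbTE jk) mulr0.
Qed.

(** [Phi] may have infinite support; both directions are still local transforms with finite sums. *)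
Lemma slocc_cut_sum b (Psi Phi : multimode R K) (I J : {set K}) r :
  (forall k : {ffun _ -> nat}, Psi k != 0 -> forall i, (k i <= b)%N) ->
  slocc_equiv Psi Phi -> bipartition I J ->
  cut_sum I J Psi r <-> cut_sum I J Phi r.
Proof.
move=> supp [A [AA [Ainv AAA ->]]] IJ.
rewrite (tensor_op_local_transform supp AAA); split.
  exact: cut_sum_local_transform.
set q := fun _ => _.
(* Only the [Psi] of the conclusion is rewritten, as a local transform of the image. *)
have [|T [q' {2}->]] := @local_transform_inv _ _ Psi b q _ supp.
  by move=> i; exact: bounded_invertible_free.
exact: cut_sum_local_transform.
Qed.

End Slocc.

(** * Graded form of the split number states *)

Lemma sqrtr_prod (R : rcfType) (I : finType) (f : I -> R) :
  (forall i, 0 <= f i) -> Num.sqrt (\prod_i f i) = \prod_i Num.sqrt (f i).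
Proof.
move=> f0; elim/big_rec2: _ => [|i x y _ <-]; first exact: sqrtr1.
by rewrite sqrtrM.
Qed.

Section SplitNumber.
Variables (R : realType) (m : nat).

(** The factor depending on the total particle number, in the role of [d]; [split_weight] plays the
    role of [w]. *)
Definition split_scale n j : R[i] :=
  if j == n then (Num.sqrt (n`!%:R) / Num.sqrt m%:R ^+ n)%:C else 0.

Definition split_weight j : R[i] := ((Num.sqrt (j`!%:R))^-1)%:C.

Lemma split_numberE n (k : {ffun 'I_m -> nat}) :
  split_number R m n k =
  split_scale n (\sum_i k i)%N * \prod_i split_weight (k i).
Proof.
rewrite /= /split_coef /split_scale; case: ifP => [_|]; last by rewrite mul0r.
rewrite /split_weight -rmorph_prod -rmorphM/=; congr (_%:C).
rewrite mulrAC sqrtrM ?ler0n//; congr (_ * _ / _).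
rewrite natr_prod -prodfV sqrtr_prod => [|i]; last by rewrite invr_ge0 ler0n.
by apply: eq_bigr => i _; rewrite sqrtrV ?ler0n.
Qed.

Lemma split_scale_gt n j : (n < j)%N -> split_scale n j = 0.
Proof. by move=> nj; rewrite /split_scale gtn_eqF. Qed.

Lemma split_scale_neq0 n : (0 < m)%N -> split_scale n n != 0.
Proof.
move=> m0; rewrite /split_scale eqxx fmorph_eq0.
by rewrite mulf_neq0 ?invr_eq0 ?expf_neq0// gt_eqF// sqrtr_gt0 ltr0n ?fact_gt0.
Qed.

Lemma split_weight_neq0 j : split_weight j != 0.
Proof.
by rewrite /split_weight fmorph_eq0 invr_eq0 gt_eqF// sqrtr_gt0 ltr0n fact_gt0.
Qed.

Lemma split_number_supp n (k : {ffun 'I_m -> nat}) :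
  split_number R m n k != 0 -> forall i, (k i <= n)%N.
Proof.
rewrite split_numberE /split_scale; case: ifP => [/eqP <- _ i|_].
  by rewrite (bigD1 i)//= leq_addr.
by rewrite mul0r eqxx.
Qed.

Lemma split_number_cut_sum n (I J : {set 'I_m}) r :
  (0 < m)%N -> bipartition I J ->
  cut_sum I J (split_number R m n) r -> (n < r)%N.
Proof.
move=> m0; apply: (cut_sum_graded_lt (split_numberE n)).
- exact: split_scale_gt.
- exact: split_scale_neq0.
- exact: split_weight_neq0.
Qed.

Lemma cut_sum_split_number n (I J : {set 'I_m}) :
  bipartition I J -> cut_sum I J (split_number R m n) n.+1.
Proof.
move=> IJ; apply: tensor_sum_cut_sum.
apply: (tensor_sum_graded (split_numberE n)) => //; exact: split_scale_gt.
Qed.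

End SplitNumber.

(** * Superpositions and SLOCC-inequivalence *)

Lemma bipartition_exists m : (2 <= m)%N ->
  exists I J : {set 'I_m}, bipartition I J.
Proof.
case: m => [|[|m]]// _; exists [set ord0]%SET, (~: [set ord0])%SET; split.
- by apply/set0Pn; exists ord0; rewrite inE.
- by apply/set0Pn; exists ord_max; rewrite !inE.
- exact: finset.setICr.
- exact: finset.setUCr.
Qed.

Theorem mainTheorem3 (R : realType) (m N : nat) (c : 'I_N.+1 -> R[i])
    (hm : (2 <= m)%N) (hc : c ord_max != 0) :
  let Psi : multimode R 'I_m :=
    \sum_(n < N.+1) c n *: split_number R m n in
  [/\ forall I J : {set 'I_m}, bipartition I J ->
        schmidt_rank I J Psi = (N.+1%:R)%:E,
      N <> 0%N -> genuinely_entangled Psi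
    & forall n n' : nat, n <> n' ->
        ~ slocc_equiv (split_number R m n) (split_number R m n')].
Proof.
move=> Psi; have m0 : (0 < m)%N by exact: ltnW.
have rankPsi I J : bipartition I J -> schmidt_rank I J Psi = (N.+1%:R)%:E.
  (* All [split_number] share the same weights, so the superposition is graded with the scales
     summed. *)
  apply: (@schmidt_rank_graded _ _ N
      (fun j => \sum_(n < N.+1) c n * split_scale R m n j) (split_weight R)).
  - move=> k; rewrite coef_sum mulr_suml; apply: eq_bigr => n _.
    by rewrite coefZ split_numberE mulrA.
  - move=> j Nj; rewrite big1// => n _.
    by rewrite split_scale_gt ?mulr0// (leq_trans (ltn_ord n)).
  (* At degree [N] only the top term survives, with factor [c ord_max]. *)
  - rewrite big_ord_recr/= big1 ?add0r => [|n _].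
      by rewrite mulf_neq0 ?split_scale_neq0.
    by rewrite split_scale_gt ?mulr0/=.
  - exact: split_weight_neq0.
split=> // [N0 I J IJ|n n' nn' slocc].
  by rewrite rankPsi// lte_fin ltr1n ltnS lt0n; apply/eqP.
have [I [J IJ]] := bipartition_exists hm.
have cutE r := slocc_cut_sum r (@split_number_supp R m n) slocc IJ.
apply: nn'; apply/eqP; rewrite eqn_leq.
(* The [n' + 1] terms for the image pull back to the source, giving [n <= n']; pushing forward gives
   the converse. *)
have /(split_number_cut_sum m0 IJ) := (cutE _).2 (cut_sum_split_number R n' IJ).
have /(split_number_cut_sum m0 IJ) := (cutE _).1 (cut_sum_split_number R n IJ).
by rewrite !ltnS => -> ->.
Qed.
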